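(* Let $(M,\psi)$ be a finite-dimensional involutive $\mathbf U$-module. Then $M$, regarded as a $\mathbf U^\imath$-module by restriction, is an $\imath$-involutive $\mathbf U^\imath$-module with involution $\psi_\imath:=\Upsilon\circ\psi$.
   Context: Let $q$ be an indeterminate and fix $r\in\mathbb N=\{0,1,2,\dots\}$. Put $\mathbb I=\{-r,\dots,r\}$, $\mathbb I^\imath=\{1,\dots,r\}$, $(\varepsilon_a,\varepsilon_b)=\delta_{ab}$ for $a,b\in\{-r-\frac12,\dots,r+\frac12\}$, $\alpha_i=\varepsilon_{i-\frac12}-\varepsilon_{i+\frac12}$ ($i\in\mathbb I$), $\Pi=\{\alpha_i\}$, $\mathrm{ht}(\sum c_i\alpha_i)=\sum c_i$. $\mathbf U=\mathbf U_q(\mathfrak{sl}_{2r+2})$ is the $\mathbb Q(q)$-algebra generated by $E_{\alpha_i},F_{\alpha_i},K_{\alpha_i}^{\pm1}$ ($i\in\mathbb I$) with commuting $K$'s, $K_{\alpha_i}E_{\alpha_j}K_{\alpha_i}^{-1}=q^{(\alpha_i,\alpha_j)}E_{\alpha_j}$, $K_{\alpha_i}F_{\alpha_j}K_{\alpha_i}^{-1}=q^{-(\alpha_i,\alpha_j)}F_{\alpha_j}$, $[E_{\alpha_i},F_{\alpha_j}]=\delta_{ij}\frac{K_{\alpha_i}-K_{\alpha_i}^{-1}}{q-q^{-1}}$ and the quantum Serre relations. $\mathbf U^+,\mathbf U^0,\mathbf U^-$ are the subalgebras generated by the $E$'s, $K^{\pm1}$'s, $F$'s; $\mathbf U^-_{-\mu}$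 is the weight $-\mu$ part. $\psi$ is the anti-linear ($q\mapsto q^{-1}$) bar involution of $\mathbf U$ fixing $E_{\alpha_i},F_{\alpha_i}$ and inverting $K_{\alpha_i}$. $\mathbf U^\imath$ is the $\mathbb Q(q)$-subalgebra of $\mathbf U$ generated, for $i\in\mathbb I^\imath$, by $k_{\alpha_i}^{\pm1}=(K_{\alpha_i}K_{\alpha_{-i}}^{-1})^{\pm1}$, $e_{\alpha_i}=E_{\alpha_i}+K_{\alpha_i}^{-1}F_{\alpha_{-i}}$, $f_{\alpha_i}=F_{\alpha_i}K_{\alpha_{-i}}^{-1}+E_{\alpha_{-i}}$, and by $t=E_{\alpha_0}+qF_{\alpha_0}K_{\alpha_0}^{-1}+K_{\alpha_0}^{-1}$. (The paper presents $\mathbf U^\imath$ by generators and relations and embeds it in $\mathbf U$ this way.) It has its own anti-linear bar involution $\psi_\imath$, fixing $e_{\alpha_i},f_{\alpha_i},t$ and inverting $k_{\alpha_i}$. $\Upsilon=\sum_{\mu\in\mathbb N\Pi}\Upsilon_\mu$, $\Upsilon_\mu\in\mathbf U^-_{-\mu}$ (in the completion of $\mathbf U$ with respect to $\mathbf U^+\mathbf U^0\sum_{\mathrm{ht}(\mu)\ge N}\mathbf U^-_{-\mu}$), is the unique such element with $\Upsilon_0=1$ and $\psi_\imath(u)\Upsilon=\Upsilon\psi(u)$ for all $u\in\mathbf U^\imath$; it acts on any finite-dimensional $\mathbf U$-module. A $\mathbf U$-module $M$ with an anti-linear involution $\psi:M\to M$ is involutive if $\psi(um)=\psi(u)\psi(m)$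 for all $u\in\mathbf U$, $m\in M$. A $\mathbf U^\imath$-module $M$ with an anti-linear involution $\psi_\imath:M\to M$ is $\imath$-involutive if $\psi_\imath(um)=\psi_\imath(u)\psi_\imath(m)$ for all $u\in\mathbf U^\imath$, $m\in M$. *)

(* Defs.v *)
From HB Require Import structures.
From mathcomp Require Import all_boot all_order all_algebra.
From mathcomp Require Import boolp classical_sets fsbigop.
Set Implicit Arguments.
Unset Strict Implicit.
Unset Printing Implicit Defensive.
Import GRing.Theory.
Local Open Scope ring_scope.
Local Open Scope quotient_scope.

Local Notation "x %:F" := (FracField.tofrac x).

Definition Qq : fieldType := {fraction {poly rat}}.

Definition q : Qq := ('X : {poly rat})%:F.

(* p(q^-1) for a polynomial p = p(q) *)
Definition eval_qV (p : {poly rat}) : Qq :=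
  (map_poly (fun a : rat => (a%:P)%:F : Qq) p).[q^-1].

(* The automorphism q |-> q^-1 of Q(q), applied to a representative fraction. *)
Definition barq (c : Qq) : Qq := eval_qV \n_(repr c) / eval_qV \d_(repr c).

Definition antilinear (V W : lmodType Qq) (f : V -> W) : Prop :=
  forall (c : Qq) (x y : V), f (c *: x + y) = barq c *: f x + f y.

(* An index i in {-r, ..., r} is encoded by the ordinal i + r in 'I_(2r+1),
   and a in {-r-1/2, ..., r+1/2} by a + r + 1/2 in 'I_(2r+2).  Thus i > 0 reads
   [r < i], the index -i is [rev_ord i], and the index 0 is [idx0 r]. *)

Section RootData.
Variable r : nat.

Definition idx0 : 'I_r.*2.+1 := inord r.

Definition eps (k : nat) : 'rV[int]_(r.*2.+2) := delta_mx 0 (inord k).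

Definition wform (x y : 'rV[int]_(r.*2.+2)) : int := (x *m y^T) 0 0.

Definition alpha (i : 'I_r.*2.+1) : 'rV[int]_(r.*2.+2) := eps i - eps i.+1.

(* N Pi: mu stands for \sum_i (mu i) alpha_i *)
Definition Qplus : Type := {ffun 'I_r.*2.+1 -> nat}.
HB.instance Definition _ := Choice.on Qplus.

Definition root_of (mu : Qplus) : 'rV[int]_(r.*2.+2) :=
  \sum_i alpha i *+ mu i.

Definition ht (mu : Qplus) : nat := (\sum_i mu i)%N.

Definition mu0 : Qplus := [ffun => 0%N].

End RootData.

(* U_q(sl_(2r+2)) is the set of noncommutative polynomial expressions in the
   generators modulo the smallest congruence [ueq] that contains the axioms of
   associative unital Q(q)-algebras and the defining relations. *)
Section QuantumGroup.
Variable r : nat.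
Local Notation I := 'I_r.*2.+1.

Inductive uterm : Type :=
| tE of I | tF of I | tK of I | tKV of I
| tC of Qq
| tD of uterm & uterm
| tM of uterm & uterm.

Local Notation "x |+| y" := (tD x y) (at level 50, left associativity).
Local Notation "x |*| y" := (tM x y) (at level 40, left associativity).

(* x^2 y - (q + q^-1) x y x + y x^2 *)
Definition tserre (x y : uterm) : uterm :=
  x |*| x |*| y |+| tC (- (q + q^-1)) |*| (x |*| y |*| x) |+| y |*| x |*| x.

Inductive ueq : uterm -> uterm -> Prop :=
| ueq_refl x : ueq x x
| ueq_sym x y : ueq x y -> ueq y x
| ueq_trans x y z : ueq x y -> ueq y z -> ueq x z
| ueq_D x x' y y' : ueq x x' -> ueq y y' -> ueq (x |+| y) (x' |+| y')
| ueq_M x x' y y' : ueq x x' -> ueq y y' -> ueq (x |*| y) (x' |*| y')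
| ueq_DA x y z : ueq (x |+| (y |+| z)) (x |+| y |+| z)
| ueq_DC x y : ueq (x |+| y) (y |+| x)
| ueq_0D x : ueq (tC 0 |+| x) x
| ueq_MA x y z : ueq (x |*| (y |*| z)) (x |*| y |*| z)
| ueq_1M x : ueq (tC 1 |*| x) x
| ueq_0M x : ueq (tC 0 |*| x) (tC 0)
| ueq_MDl x y z : ueq ((x |+| y) |*| z) (x |*| z |+| y |*| z)
| ueq_MDr x y z : ueq (x |*| (y |+| z)) (x |*| y |+| x |*| z)
| ueq_CD a b : ueq (tC (a + b)) (tC a |+| tC b)
| ueq_CM a b : ueq (tC (a * b)) (tC a |*| tC b)
| ueq_CX a x : ueq (tC a |*| x) (x |*| tC a)
| ueq_KKV i : ueq (tK i |*| tKV i) (tC 1)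
| ueq_KVK i : ueq (tKV i |*| tK i) (tC 1)
| ueq_KK i j : ueq (tK i |*| tK j) (tK j |*| tK i)
| ueq_KE i j :
    ueq (tK i |*| tE j |*| tKV i) (tC (q ^ wform (alpha i) (alpha j)) |*| tE j)
| ueq_KF i j :
    ueq (tK i |*| tF j |*| tKV i) (tC (q ^ (- wform (alpha i) (alpha j))) |*| tF j)
| ueq_EF i j :
    ueq (tE i |*| tF j |+| tC (-1) |*| (tF j |*| tE i))
        (tC ((i == j)%:R / (q - q^-1)) |*| (tK i |+| tC (-1) |*| tKV i))
| ueq_serreE i j : wform (alpha i) (alpha j) = -1 ->
    ueq (tserre (tE i) (tE j)) (tC 0)
| ueq_serreF i j : wform (alpha i) (alpha j) = -1 ->
    ueq (tserre (tF i) (tF j)) (tC 0)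
| ueq_commE i j : wform (alpha i) (alpha j) = 0 ->
    ueq (tE i |*| tE j) (tE j |*| tE i)
| ueq_commF i j : wform (alpha i) (alpha j) = 0 ->
    ueq (tF i |*| tF j) (tF j |*| tF i).

HB.instance Definition _ := gen_eqMixin uterm.
HB.instance Definition _ := gen_choiceMixin uterm.

Definition ueqb (x y : uterm) : bool := `[< ueq x y >].

Lemma ueqb_refl : reflexive ueqb.
Proof. by move=> x; apply/asboolP; apply: ueq_refl. Qed.
Lemma ueqb_sym : symmetric ueqb.
Proof. by move=> x y; apply/asboolP/asboolP; apply: ueq_sym. Qed.
Lemma ueqb_trans : transitive ueqb.
Proof. by move=> y x z /asboolP h /asboolP k; apply/asboolP/(ueq_trans h). Qed.

Canonical ueq_equiv := EquivRel ueqb ueqb_refl ueqb_sym ueqb_trans.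

Definition U : Type := {eq_quot ueqb}.
HB.instance Definition _ := Choice.on U.
HB.instance Definition _ : EqQuotient _ ueqb U := EqQuotient.on U.

Lemma ueqP (x y : uterm) : ueq x y <-> \pi_U x = \pi_U y.
Proof.
split=> [h|h]; first by apply/eqmodP/asboolP.
by apply/asboolP; move/eqmodP: h.
Qed.

Definition uadd (x y : U) : U := \pi_U (tD (repr x) (repr y)).
Definition umul (x y : U) : U := \pi_U (tM (repr x) (repr y)).
Definition uscale (c : Qq) (x : U) : U := \pi_U (tM (tC c) (repr x)).
Definition uopp (x : U) : U := uscale (-1) x.

Lemma repr_ueq x : ueq (repr (\pi_U x)) x.
Proof. by apply/ueqP; rewrite reprK. Qed.

Lemma uadd_pi x y : uadd (\pi_U x) (\pi_U y) = \pi_U (tD x y).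
Proof. by apply/ueqP; apply: ueq_D; apply: repr_ueq. Qed.
Lemma umul_pi x y : umul (\pi_U x) (\pi_U y) = \pi_U (tM x y).
Proof. by apply/ueqP; apply: ueq_M; apply: repr_ueq. Qed.
Lemma uscale_pi c x : uscale c (\pi_U x) = \pi_U (tM (tC c) x).
Proof. by apply/ueqP; apply: ueq_M; [apply: ueq_refl|apply: repr_ueq]. Qed.

Lemma uaddA : associative uadd.
Proof.
elim/quotW=> x; elim/quotW=> y; elim/quotW=> z.
rewrite (uadd_pi y z) (uadd_pi x y) !uadd_pi.
by apply/ueqP; apply: ueq_DA.
Qed.
Lemma uaddC : commutative uadd.
Proof.
by elim/quotW=> x; elim/quotW=> y; rewrite ?uscale_pi ?uadd_pi ?umul_pi; apply/ueqP; apply: ueq_DC.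
Qed.
Lemma uadd0 : left_id (\pi_U (tC 0)) uadd.
Proof. by elim/quotW=> x; rewrite ?uscale_pi ?uadd_pi ?umul_pi; apply/ueqP; apply: ueq_0D. Qed.
Lemma uaddN : left_inverse (\pi_U (tC 0)) uopp uadd.
Proof.
elim/quotW=> x; rewrite /uopp uscale_pi uadd_pi; apply/ueqP.
apply: (@ueq_trans _ (tC (-1) |*| x |+| tC 1 |*| x)).
  by apply: ueq_D; [apply: ueq_refl|apply/ueq_sym/ueq_1M].
apply: ueq_trans (ueq_sym (ueq_MDl _ _ _)) _.
apply: ueq_trans (ueq_0M x); apply: ueq_M; last exact: ueq_refl.
by apply: ueq_sym; rewrite -[X in tC X](addNr 1); apply: ueq_CD.
Qed.
HB.instance Definition _ := GRing.isZmodule.Build U uaddA uaddC uadd0 uaddN.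

Lemma umulA : associative umul.
Proof.
elim/quotW=> x; elim/quotW=> y; elim/quotW=> z.
rewrite (umul_pi y z) (umul_pi x y) !umul_pi.
by apply/ueqP; apply: ueq_MA.
Qed.
Lemma umul1l : left_id (\pi_U (tC 1)) umul.
Proof. by elim/quotW=> x; rewrite ?uscale_pi ?uadd_pi ?umul_pi; apply/ueqP; apply: ueq_1M. Qed.
Lemma umul1r : right_id (\pi_U (tC 1)) umul.
Proof.
elim/quotW=> x; rewrite ?uscale_pi ?uadd_pi ?umul_pi; apply/ueqP.
exact: ueq_trans (ueq_sym (ueq_CX _ _)) (ueq_1M _).
Qed.
Lemma umulDl : left_distributive umul uadd.
Proof.
elim/quotW=> x; elim/quotW=> y; elim/quotW=> z.
rewrite (uadd_pi x y) (umul_pi x z) (umul_pi y z) umul_pi uadd_pi.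
by apply/ueqP; apply: ueq_MDl.
Qed.
Lemma umulDr : right_distributive umul uadd.
Proof.
elim/quotW=> x; elim/quotW=> y; elim/quotW=> z.
rewrite (uadd_pi y z) (umul_pi x y) (umul_pi x z) umul_pi uadd_pi.
by apply/ueqP; apply: ueq_MDr.
Qed.

(* The counit (E, F |-> 0, K |-> 1), which shows that 1 != 0 in U. *)
Fixpoint counit (x : uterm) : Qq :=
  match x with
  | tE _ | tF _ => 0
  | tK _ | tKV _ => 1
  | tC c => c
  | tD x y => counit x + counit y
  | tM x y => counit x * counit y
  end.

Lemma counit_ueq x y : ueq x y -> counit x = counit y.
Proof.
elim=> //=; rewrite ?(mulr0, mul0r, addr0, mulr1, mul1r, subrr) //.
- by move=> x0 y0 z0 _ -> _ ->.
- by move=> x0 x' y0 y' _ -> _ ->.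
- by move=> x0 x' y0 y' _ -> _ ->.
all: intros; rewrite ?(mulr0, mul0r, addr0, add0r, mulr1, mul1r, subrr) //.
- exact: addrA.
- exact: addrC.
- exact: mulrA.
- exact: mulrDl.
- exact: mulrDr.
- exact: mulrC.
Qed.

Lemma uone_neq0 : \pi_U (tC 1) != \pi_U (tC 0).
Proof.
by apply/eqP=> /ueqP /counit_ueq /= /eqP; rewrite oner_eq0.
Qed.
HB.instance Definition _ := GRing.Zmodule_isNzRing.Build U
  umulA umul1l umul1r umulDl umulDr uone_neq0.

Lemma uscaleA a b x : uscale a (uscale b x) = uscale (a * b) x.
Proof.
elim/quotW: x => x; rewrite (uscale_pi b) !uscale_pi; apply/ueqP.
apply: ueq_trans (ueq_MA _ _ _) _; apply: ueq_M; last exact: ueq_refl.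
exact/ueq_sym/ueq_CM.
Qed.
Lemma uscale1 : left_id 1 uscale.
Proof. by elim/quotW=> x; rewrite ?uscale_pi ?uadd_pi ?umul_pi; apply/ueqP; apply: ueq_1M. Qed.
Lemma uscaleDr : right_distributive uscale +%R.
Proof.
move=> c; elim/quotW=> x; elim/quotW=> y.
change (uscale c (uadd (\pi x) (\pi y)) = uadd (uscale c (\pi x)) (uscale c (\pi y))).
rewrite uadd_pi (uscale_pi c x) (uscale_pi c y) uscale_pi uadd_pi.
by apply/ueqP; apply: ueq_MDr.
Qed.
Lemma uscaleDl (x : U) : {morph uscale^~ x : a b / a + b}.
Proof.
move=> a b /=; elim/quotW: x => x.
change (uscale (a + b) (\pi x) = uadd (uscale a (\pi x)) (uscale b (\pi x))).
rewrite !uscale_pi uadd_pi; apply/ueqP.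
apply: ueq_trans (ueq_MDl _ _ _); apply: ueq_M; last exact: ueq_refl.
exact: ueq_CD.
Qed.
HB.instance Definition _ := GRing.Zmodule_isLmodule.Build Qq U
  uscaleA uscale1 uscaleDr uscaleDl.

Lemma uscaleAl (c : Qq) (x y : U) : c *: (x * y) = (c *: x) * y.
Proof.
elim/quotW: x => x; elim/quotW: y => y.
change (uscale c (umul (\pi x) (\pi y)) = umul (uscale c (\pi x)) (\pi y)).
rewrite umul_pi (uscale_pi c x) uscale_pi umul_pi.
by apply/ueqP/ueq_MA.
Qed.
HB.instance Definition _ := GRing.Lmodule_isLalgebra.Build Qq U uscaleAl.

Lemma uscaleAr (c : Qq) (x y : U) : c *: (x * y) = x * (c *: y).
Proof.
elim/quotW: x => x; elim/quotW: y => y.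
change (uscale c (umul (\pi x) (\pi y)) = umul (\pi x) (uscale c (\pi y))).
rewrite umul_pi (uscale_pi c y) uscale_pi umul_pi; apply/ueqP.
apply: ueq_trans (ueq_MA _ _ _) (ueq_trans _ (ueq_sym (ueq_MA _ _ _))).
by apply: ueq_M; [apply: ueq_CX | apply: ueq_refl].
Qed.
HB.instance Definition _ := GRing.Lalgebra_isAlgebra.Build Qq U uscaleAr.

Definition E_ (i : I) : U := \pi_U (tE i).
Definition F_ (i : I) : U := \pi_U (tF i).
Definition K_ (i : I) : U := \pi_U (tK i).
Definition KV_ (i : I) : U := \pi_U (tKV i).

End QuantumGroup.

Inductive lspan (V : lmodType Qq) (S : V -> Prop) : V -> Prop :=
| lspan0 : lspan S 0
| lspanZD c x y : S x -> lspan S y -> lspan S (c *: x + y).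

Inductive subalg (A : algType Qq) (S : A -> Prop) : A -> Prop :=
| subalg_gen x : S x -> subalg S x
| subalg_scalar c : subalg S c%:A
| subalg_add x y : subalg S x -> subalg S y -> subalg S (x + y)
| subalg_mul x y : subalg S x -> subalg S y -> subalg S (x * y).

Section Subalgebras.
Variable r : nat.
Local Notation I := 'I_r.*2.+1.
Local Notation U := (U r).
Local Notation Qplus := (Qplus r).

Definition Uplus : U -> Prop := subalg (fun x : U => exists i, x = E_ i).
Definition Uminus : U -> Prop := subalg (fun x : U => exists i, x = F_ i).
Definition Uzero : U -> Prop :=
  subalg (fun x : U => exists i, x = K_ i \/ x = KV_ i).

(* U^-_(-mu) *)
Definition Uminus_wt (mu : Qplus) (x : U) : Prop :=
  Uminus x /\
  forall i : I, K_ i * x * KV_ i = q ^ (- wform (alpha i) (root_of mu)) *: x.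

(* k_(alpha_i)^(+-1), e_(alpha_i), f_(alpha_i) (for i > 0) and t *)
Definition ki (i : I) : U := K_ i * KV_ (rev_ord i).
Definition kiV (i : I) : U := K_ (rev_ord i) * KV_ i.
Definition ei (i : I) : U := E_ i + KV_ i * F_ (rev_ord i).
Definition fi (i : I) : U := F_ i * KV_ (rev_ord i) + E_ (rev_ord i).
Definition ti : U :=
  E_ (idx0 r) + q *: (F_ (idx0 r) * KV_ (idx0 r)) + KV_ (idx0 r).

Inductive Ui_gen : U -> Prop :=
| Ui_k (i : I) : (r < i)%N -> Ui_gen (ki i)
| Ui_kV (i : I) : (r < i)%N -> Ui_gen (kiV i)
| Ui_e (i : I) : (r < i)%N -> Ui_gen (ei i)
| Ui_f (i : I) : (r < i)%N -> Ui_gen (fi i)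
| Ui_t : Ui_gen ti.

Definition in_Ui : {pred U} := fun x : U => `[< subalg Ui_gen x >].

Lemma in_Ui_closed : GRing.subsemialg_closed in_Ui.
Proof.
split; last by move=> x y /asboolP hx /asboolP hy; apply/asboolP/subalg_mul.
- by apply/asboolP; rewrite -(scale1r 1); apply: subalg_scalar.
- split; first by apply/asboolP; rewrite -(scale0r 1); apply: subalg_scalar.
  by move=> x y /asboolP hx /asboolP hy; apply/asboolP/subalg_add.
- move=> c x /asboolP hx; apply/asboolP; rewrite -[x]mul1r scalerAl.
  exact/subalg_mul/hx/subalg_scalar.
Qed.

Record Ui : Type := MkUi { Ui_val :> U; _ : in_Ui Ui_val }.
HB.instance Definition _ := [isSub for Ui_val].
HB.instance Definition _ := [Choice of Ui by <:].
HB.instance Definition _ :=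
  GRing.SubChoice_isSubAlgebra.Build Qq U in_Ui Ui in_Ui_closed.

(* U^+ U^0 \sum_(ht mu >= N) U^-_(-mu) *)
Definition Jideal (N : nat) : U -> Prop :=
  lspan (fun x : U => exists a b c mu,
    [/\ Uplus a, Uzero b, Uminus_wt mu c, (N <= ht mu)%N & x = a * b * c]).

(* An element of the completion is represented by a Cauchy sequence in U for
   the topology defined by the [Jideal N]; two sequences represent the same
   element when their difference tends to 0.  Left and right multiplication by
   a fixed element of U are continuous (every [Jideal N] is a left ideal, and
   for each u and N some [Jideal N'] * u lies in [Jideal N]), so they are
   computed termwise. *)
Definition compl_eq (x y : nat -> U) : Prop :=
  forall N, exists n0, forall n, (n0 <= n)%N -> Jideal N (x n - y n).

(* The sequence of partial sums that represents \sum_mu Y_mu. *)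
Definition compl_sum (Y : Qplus -> U) (n : nat) : U :=
  \sum_(mu \in [set mu : Qplus | (ht mu < n)%N]) Y mu.

End Subalgebras.

Definition antilinear_alg_involution (A : algType Qq) (f : A -> A) : Prop :=
  [/\ antilinear f, f 1 = 1, {morph f : x y / x * y} & involutive f].

Definition is_bar_U (r : nat) (psi : U r -> U r) : Prop :=
  antilinear_alg_involution psi /\
  forall i, [/\ psi (E_ i) = E_ i, psi (F_ i) = F_ i & psi (K_ i) = KV_ i].

Definition is_bar_Ui (r : nat) (psii : Ui r -> Ui r) : Prop :=
  [/\ antilinear_alg_involution psii,
      forall (i : 'I_r.*2.+1) (u : Ui r), (r < i)%N ->
        [/\ val u = ei i -> psii u = u,
            val u = fi i -> psii u = u &
            val u = ki i -> val (psii u) = kiV i] &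
      forall u : Ui r, val u = ti r -> psii u = u].

Section Upsilon.
Variables (r : nat) (psi : U r -> U r) (psii : Ui r -> Ui r).

Definition Upsilon_spec (Y : Qplus r -> U r) : Prop :=
  [/\ forall mu, Uminus_wt mu (Y mu),
      Y (mu0 r) = 1 &
      forall u : Ui r, compl_eq (fun n => val (psii u) * compl_sum Y n)
                                (fun n => compl_sum Y n * psi (val u))].

(* Y is the unique solution of [Upsilon_spec], as an element of the
   completion. *)
Definition is_Upsilon (Y : Qplus r -> U r) : Prop :=
  Upsilon_spec Y /\
  forall Y', Upsilon_spec Y' -> compl_eq (compl_sum Y') (compl_sum Y).

End Upsilon.

Section Modules.
Variables (A : algType Qq) (M : vectType Qq).

Definition is_module (rho : A -> 'End(M)) : Prop :=
  [/\ linear rho, rho 1 = \1%VF &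
      forall a b, rho (a * b) = (rho a \o rho b)%VF].

(* For A = U this is "involutive", for A = U^i it is "i-involutive". *)
Definition involutive_module (bar : A -> A) (rho : A -> 'End(M))
    (psi : M -> M) : Prop :=
  [/\ is_module rho, antilinear psi, involutive psi &
      forall (a : A) (m : M), psi (rho a m) = rho (bar a) (psi m)].

End Modules.

(* The action of \sum_mu Y_mu on a finite-dimensional U-module, on which all
   but finitely many of the U^-_(-mu) act by zero: the sum below runs over the
   mu with Y_mu m != 0. *)
Definition compl_act (r : nat) (M : vectType Qq) (rho : U r -> 'End(M))
    (Y : Qplus r -> U r) (m : M) : M :=
  \sum_(mu \in [set: Qplus r]) rho (Y mu) m.

Definition restrict_Ui (r : nat) (M : vectType Qq) (rho : U r -> 'End(M))
    (u : Ui r) : 'End(M) := rho (val u).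

(* Main.v *)
(* Conjugating the relation psii(u) Y = Y psi(u) by psi gives
   psi(u) psi(Y) = psi(Y) psii(u), so Y psi(Y) Y is again an intertwiner with
   constant term 1 and equals Y by uniqueness.  On a finite-dimensional module
   Y acts by a unipotent operator, hence Y psi(Y) acts by 1, which is the
   statement that Y o psi is an involution.  Finiteness of the action comes from
   the height grading: conjugation by K_(2 rho) has the distinct eigenvalues
   q^(-2n) on the words of length n in the F_i, so on a finite-dimensional module
   all long words act by 0. *)
Require Import Defs.
From HB Require Import structures.
From mathcomp Require Import all_boot all_order all_algebra.
From mathcomp Require Import boolp classical_sets fsbigop.
From mathcomp Require Import zify.

Set Implicit Arguments.
Unset Strict Implicit.
Unset Printing Implicit Defensive.
Import GRing.Theory.
Local Open Scope ring_scope.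
Local Open Scope quotient_scope.

(** * Linear spans and scalars *)

Section LinearSpan.
Variables (V : lmodType Qq).
Implicit Types (S T : V -> Prop).

Lemma lspan_gen S x : S x -> lspan S x.
Proof. by move=> Sx; rewrite -[x]addr0 -[x]scale1r; apply/lspanZD/lspan0. Qed.

Lemma lspan_add S x y : lspan S x -> lspan S y -> lspan S (x + y).
Proof.
by move=> Sx Sy; elim: Sx => [|c u v Su _ IH]; rewrite ?add0r // -addrA; apply: lspanZD.
Qed.

Lemma lspan_scale S c x : lspan S x -> lspan S (c *: x).
Proof.
elim=> [|d u v Su _ IH]; first by rewrite scaler0; apply: lspan0.
by rewrite scalerDr scalerA; apply: lspanZD.
Qed.

Lemma lspan_sub S x y : lspan S x -> lspan S y -> lspan S (x - y).
Proof. by move=> Sx Sy; rewrite -scaleN1r; apply/lspan_add/lspan_scale. Qed.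

Lemma lspan_sum S (J : Type) (s : seq J) (P : pred J) (f : J -> V) :
  (forall j, P j -> lspan S (f j)) -> lspan S (\sum_(j <- s | P j) f j).
Proof. by move=> Sf; apply: big_ind => //; [apply: lspan0 | apply: lspan_add]. Qed.

End LinearSpan.

Lemma lspan_lin (V W : lmodType Qq) (S : V -> Prop) (T : W -> Prop) (f : V -> W) :
  linear f -> (forall x, S x -> lspan T (f x)) -> forall x, lspan S x -> lspan T (f x).
Proof.
move=> linf ST x; elim=> [|c u v Su _ IH]; last first.
  by rewrite linf; apply/lspan_add/IH/lspan_scale/ST.
suff -> : f 0 = 0 by apply: lspan0.
by apply: (addrI (f 0)); have := linf 1 0 0; rewrite !scale1r !addr0.
Qed.

Lemma lspan_sup (V : lmodType Qq) (S T : V -> Prop) :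
  (forall x, S x -> lspan T x) -> forall x, lspan S x -> lspan T x.
Proof. exact: (@lspan_lin _ _ S T id). Qed.

Lemma lspan_mul (A : algType Qq) (S T R : A -> Prop) :
  (forall x y, S x -> T y -> lspan R (x * y)) ->
  forall x y, lspan S x -> lspan T y -> lspan R (x * y).
Proof.
move=> STR x y Sx Ty.
apply: (@lspan_lin _ _ S R ( *%R^~ y)) Sx => [c u v|u Su].
  by rewrite mulrDl scalerAl.
apply: (@lspan_lin _ _ T R ( *%R u)) Ty => [c v w|v Tv]; last exact: STR.
by rewrite mulrDr scalerAr.
Qed.

Lemma lspan_zero (V W : lmodType Qq) (S : V -> Prop) (f : V -> W) :
  linear f -> (forall x, S x -> f x = 0) -> forall x, lspan S x -> f x = 0.
Proof.
move=> linf Sf x /(@lspan_lin _ _ S (fun=> False) f linf); elim=> //.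
by move=> y /Sf ->; apply: lspan0.
Qed.

(** Applying [A - lam n] to the relation kills the last term and rescales the others by the nonzero
    factors [lam j - lam n], so induction applies. The [v i] may be zero, hence independence takes
    the form that every component vanishes. *)
Lemma eigenvectors_independent (F : fieldType) (V : lmodType F) (A : V -> V)
    (lam : nat -> F) (n : nat) (v : nat -> V) :
    linear A -> injective lam ->
    (forall i, (i < n)%N -> A (v i) = lam i *: v i) ->
  \sum_(i < n) v i = 0 -> forall i, (i < n)%N -> v i = 0.
Proof.
move=> linA lam_inj.
pose A' : {linear V -> V} := HB.pack A (GRing.isLinear.Build _ _ _ _ A linA).
elim: n v => // n IHn v Av sum0.
have lt_v i : (i < n)%N -> v i = 0.
  move=> lt_in.
  have eig j : (j < n)%N ->
      A ((lam j - lam n) *: v j) = lam j *: ((lam j - lam n) *: v j).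
    move=> lt_jn; rewrite [LHS](linearZ_LR A') /= Av ?ltnS ?(ltnW lt_jn) //.
    by rewrite !scalerA mulrC.
  have sum0' : \sum_(j < n) (lam j - lam n) *: v j = 0.
    transitivity (A (\sum_(j < n.+1) v j) - lam n *: \sum_(j < n.+1) v j).
      2: by rewrite sum0 scaler0 subr0 [LHS](linear0 A').
    rewrite [X in X - _](linear_sum A') /= scaler_sumr -sumrB big_ord_recr /=.
    rewrite Av // subrr addr0; apply: eq_bigr => j _.
    by rewrite Av ?ltnS ?(ltnW (ltn_ord j)) // scalerBl.
  have /eqP := IHn (fun j => (lam j - lam n) *: v j) eig sum0' i lt_in.
  rewrite scaler_eq0 subr_eq0 => /orP[/eqP/lam_inj eq_in|/eqP//].
  by rewrite eq_in ltnn in lt_in.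
move=> i; rewrite ltnS leq_eqVlt => /orP[/eqP->|]; last exact: lt_v.
by move: sum0; rewrite big_ord_recr /= big1 ?add0r // => j _; apply: lt_v.
Qed.

Lemma q_neq0 : q != 0.
Proof. by rewrite /q tofrac_eq0 polyX_eq0. Qed.

(** These are the eigenvalues of conjugation by K_(2 rho) in height [n]; they differ because q is an
    indeterminate. *)
Lemma qXV_inj : injective (fun n : nat => q ^- n.*2).
Proof.
move=> m n /= /invr_inj /eqP; rewrite /q -!tofracXn tofrac_eq => /eqP.
by move/(congr1 (fun p : {poly rat} => size p)); rewrite !size_polyXn; lia.
Qed.

Lemma eval_qV_mulX (p : {poly rat}) : eval_qV ('X * p) = q^-1 * eval_qV p.
Proof.
have -> : eval_qV =1 fun p => (map_poly (@FracField.tofrac _ \o polyC) p).[q^-1].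
  by [].
by rewrite rmorphM /= map_polyX hornerM hornerX.
Qed.

(* The hypothesis replaces a proof that the denominator does not vanish at q^-1;
   it will follow from the multiplicativity of [barq], which [psi] forces. *)
Lemma barq_q : barq q != 0 -> barq q = q^-1.
Proof.
rewrite /barq; set n := \n_(repr q); set d := \d_(repr q).
(* The fraction chosen by [repr] is unknown, but it equals X / 1, so cross-multiplication gives this
   relation. *)
suff -> : n = 'X * d.
  (* If [d] vanishes at q^-1, the convention 0^-1 = 0 makes [barq q] zero, against the
     hypothesis. *)
  rewrite eval_qV_mulX; have [->|d0 _] := eqVneq (eval_qV d) 0.
    by rewrite invr0 mulr0 eqxx.
  by rewrite mulfK.
have qE : q = \pi_({fraction {poly rat}}) (Ratio ('X : {poly rat}) 1).
  by rewrite /q; unlock FracField.tofrac.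
have := @FracField.equivf_l _ (Ratio ('X : {poly rat}) 1).
by rewrite -qE numer_Ratio ?denom_Ratio ?oner_neq0 // mulr1 mulrC.
Qed.

(** * The quantum group and its triangular decomposition *)

Section QuantumGroupTheory.
Variable r : nat.
Local Notation I := 'I_r.*2.+1.
Local Notation U := (U r).

Lemma pi_tC c : \pi_U (@tC r c) = c%:A.
Proof.
change (\pi_U (@tC r c) = uscale c (\pi_U (@tC r 1))).
rewrite uscale_pi; apply/ueqP; by have := @ueq_CM r c 1; rewrite mulr1.
Qed.

Lemma pi_tM (x y : uterm r) : \pi_U (tM x y) = \pi_U x * \pi_U y.
Proof. by rewrite -umul_pi. Qed.

Lemma pi_tD (x y : uterm r) : \pi_U (tD x y) = \pi_U x + \pi_U y.
Proof. by rewrite -uadd_pi. Qed.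

Lemma U_ind (P : U -> Prop) :
    (forall i, P (E_ i)) -> (forall i, P (F_ i)) ->
    (forall i, P (K_ i)) -> (forall i, P (KV_ i)) -> (forall c, P c%:A) ->
    (forall x y, P x -> P y -> P (x + y)) ->
    (forall x y, P x -> P y -> P (x * y)) ->
  forall x, P x.
Proof.
move=> PE PF PK PKV PC PD PM; elim/quotW; elim=> [i|i|i|i|c|x Px y Py|x Px y Py].
- exact: PE.
- exact: PF.
- exact: PK.
- exact: PKV.
- by rewrite pi_tC.
- by rewrite pi_tD; apply: PD.
- by rewrite pi_tM; apply: PM.
Qed.

Lemma K_KV (i : I) : K_ i * KV_ i = 1.
Proof. by rewrite -pi_tM -[RHS]scale1r -pi_tC; apply/ueqP/ueq_KKV. Qed.

Lemma KV_K (i : I) : KV_ i * K_ i = 1.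
Proof. by rewrite -pi_tM -[RHS]scale1r -pi_tC; apply/ueqP/ueq_KVK. Qed.

Lemma K_E_KV (i j : I) :
  K_ i * E_ j * KV_ i = q ^ wform (alpha i) (alpha j) *: E_ j.
Proof.
by have /ueqP := @ueq_KE r i j; rewrite !pi_tM pi_tC -scalerAl mul1r.
Qed.

Lemma K_F_KV (i j : I) :
  K_ i * F_ j * KV_ i = q ^ (- wform (alpha i) (alpha j)) *: F_ j.
Proof.
by have /ueqP := @ueq_KF r i j; rewrite !pi_tM pi_tC -scalerAl mul1r.
Qed.

Lemma E_F_comm (i j : I) :
  E_ i * F_ j - F_ j * E_ i = ((i == j)%:R / (q - q^-1)) *: (K_ i - KV_ i).
Proof.
have /ueqP := @ueq_EF r i j; rewrite !(pi_tD, pi_tM, pi_tC) !scaleN1r !mulN1r.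
by rewrite -scalerAl mul1r.
Qed.

Definition kgen (k : bool * I) : U := if k.1 then K_ k.2 else KV_ k.2.
Definition eword (s : seq I) : U := \prod_(i <- s) E_ i.
Definition kword (s : seq (bool * I)) : U := \prod_(k <- s) kgen k.
Definition fword (s : seq I) : U := \prod_(i <- s) F_ i.

Lemma q_exp_neq0 (m : int) : q ^ m != 0.
Proof. exact/expfz_neq0/q_neq0. Qed.

Lemma K_comm_scale (i : I) (c : Qq) (x : U) : c != 0 -> K_ i * x * KV_ i = c *: x ->
  [/\ K_ i * x = c *: (x * K_ i), x * K_ i = c^-1 *: (K_ i * x),
      KV_ i * x = c^-1 *: (x * KV_ i) & x * KV_ i = c *: (KV_ i * x)].
Proof.
move=> c0 Kx.
have Kl : K_ i * x = c *: (x * K_ i).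
  by rewrite scalerAl -Kx -!mulrA KV_K mulr1.
have Vr : x * KV_ i = c *: (KV_ i * x).
  by rewrite scalerAr -Kx !mulrA KV_K mul1r.
by split=> //; rewrite ?Kl ?Vr scalerA mulVf ?scale1r.
Qed.

Lemma kgen_E (k : bool * I) (j : I) : exists c, kgen k * E_ j = c *: (E_ j * kgen k).
Proof.
have [Kl _ Vl _] := K_comm_scale (q_exp_neq0 _) (K_E_KV k.2 j).
by case: k Kl Vl => [[] i] /= Kl Vl; eexists; [exact: Kl | exact: Vl].
Qed.

Lemma F_kgen (k : bool * I) (j : I) : exists c, F_ j * kgen k = c *: (kgen k * F_ j).
Proof.
have [_ Kr _ Vr] := K_comm_scale (q_exp_neq0 _) (K_F_KV k.2 j).
by case: k Kr Vr => [[] i] /= Kr Vr; eexists; [exact: Kr | exact: Vr].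
Qed.

Lemma kgen_eword k s : exists c, kgen k * eword s = c *: (eword s * kgen k).
Proof.
elim: s => [|i s [c IH]]; first by exists 1; rewrite /eword big_nil mulr1 mul1r scale1r.
have [d kE] := kgen_E k i; exists (d * c); rewrite /eword big_cons -/(eword s).
by rewrite mulrA kE -scalerAl -[in LHS]mulrA IH -scalerAr mulrA scalerA.
Qed.

Lemma F_kword i t : exists c, F_ i * kword t = c *: (kword t * F_ i).
Proof.
elim: t => [|k t [c IH]]; first by exists 1; rewrite /kword big_nil mulr1 mul1r scale1r.
have [d Fk] := F_kgen k i; exists (d * c); rewrite /kword big_cons -/(kword t).
by rewrite mulrA Fk -scalerAl -[in LHS]mulrA IH -scalerAr mulrA scalerA.
Qed.

Lemma fword_kgen s k : exists c, fword s * kgen k = c *: (kgen k * fword s).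
Proof.
elim: s => [|i s [c IH]]; first by exists 1; rewrite /fword big_nil mulr1 mul1r scale1r.
have [d Fk] := F_kgen k i; exists (d * c); rewrite /fword big_cons -/(fword s).
by rewrite -mulrA IH -scalerAr [F_ i * (_ * _)]mulrA Fk -scalerAl scalerA mulrA [c * d]mulrC.
Qed.

Let triangular := lspan (fun x : U => exists s t w, x = eword s * kword t * fword w).

Let triangular_mul (u : U) :
    (forall s t w, triangular (u * (eword s * kword t * fword w))) ->
  forall x, triangular x -> triangular (u * x).
Proof.
move=> Hu; apply: lspan_lin => [c x y|_ [s [t [w ->]]]]; last exact: Hu.
by rewrite mulrDr scalerAr.
Qed.

(** The spanning half of U = U^+ U^0 U^-. The span contains 1 and is stable under left
    multiplication by generators: E_i lengthens the first word, K_i^(+-1) commutes with E-words up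
    to a scalar, and F_i is pushed through the E-word by its commutators, by induction on that
    word. *)
Lemma triangular_decomposition (x : U) : triangular x.
Proof.
suff closed : forall x, forall y, triangular y -> triangular (x * y).
  rewrite -[x]mulr1; apply: closed; apply: lspan_gen; exists [::], [::], [::].
  by rewrite /eword /kword /fword !big_nil !mulr1.
have genE i y : triangular y -> triangular (E_ i * y).
  apply: triangular_mul => s t w; apply: lspan_gen; exists (i :: s), t, w.
  by rewrite /eword big_cons !mulrA.
have genK k y : triangular y -> triangular (kgen k * y).
  apply: triangular_mul => s t w; have [c kE] := kgen_eword k s.
  rewrite !mulrA kE -!scalerAl; apply/lspan_scale/lspan_gen; exists s, (k :: t), w.
  by rewrite /kword big_cons !mulrA.
elim/U_ind=> {x} [i|i|i|i|c|x y Px Py|x y Px Py] z Tz.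
- exact: genE.
- apply: triangular_mul Tz => s t w; elim: s => [|j s IH].
    have [c FK] := F_kword i t.
    rewrite /eword big_nil mul1r mulrA FK -scalerAl -mulrA.
    apply/lspan_scale/lspan_gen; exists [::], t, (i :: w).
    by rewrite /eword big_nil mul1r /fword big_cons.
  rewrite /eword big_cons -/(eword s) !mulrA.
  have -> : F_ i * E_ j = E_ j * F_ i
     - ((j == i)%:R / (q - q^-1)) *: (kgen (true, j) - kgen (false, j)).
    by rewrite -E_F_comm opprB addrC subrK.
  have T0 : triangular (eword s * kword t * fword w).
    by apply: lspan_gen; exists s, t, w.
  rewrite !mulrBl -!scalerAl !mulrBl -!mulrA !(mulrA (eword s)).
  apply: lspan_sub; first by apply: genE; rewrite !mulrA in IH *.
  by apply/lspan_scale/lspan_sub; apply: genK.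
- exact: (genK (true, i)).
- exact: (genK (false, i)).
- by rewrite -scalerAl mul1r; apply: lspan_scale.
- by rewrite mulrDl; apply: lspan_add; [apply: Px | apply: Py].
- by rewrite -mulrA; apply/Px/Py.
Qed.

End QuantumGroupTheory.

(** * Weights and heights *)

Section Weights.
Variable r : nat.
Local Notation I := 'I_r.*2.+1.
Local Notation U := (U r).
Local Notation Qplus := (Qplus r).

Lemma wformDr (x y z : 'rV[int]_(r.*2.+2)) : wform x (y + z) = wform x y + wform x z.
Proof. by rewrite /wform linearD /= mulmxDr mxE. Qed.

Lemma wform_sumr (x : 'rV[int]_(r.*2.+2)) (c : I -> nat) (y : I -> 'rV[int]_(r.*2.+2)) :
  wform x (\sum_j y j *+ c j) = \sum_j (c j)%:Z * wform x (y j).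
Proof.
rewrite /wform linear_sum /= mulmx_sumr summxE; apply: eq_bigr => j _.
by rewrite linearMn /= -scaler_nat linearZ /= mxE natz.
Qed.

Lemma wform_alphar (x : 'rV[int]_(r.*2.+2)) (j : I) :
  wform x (alpha j) = x 0 (inord j) - x 0 (inord j.+1).
Proof.
rewrite /wform mxE; under eq_bigr => k _ do rewrite !mxE mulrBr /=.
rewrite sumrB (bigD1 (inord j)) //= !eqxx mulr1 big1 => [|k /negPf k_neq].
  by rewrite addr0 (bigD1 (inord j.+1)) //= !eqxx mulr1 big1 ?addr0 // => k /negPf ->;
     rewrite mulr0.
by rewrite k_neq mulr0.
Qed.

Lemma sum_telescope (g : nat -> int) (a m : nat) :
  \sum_(i < m) g i * ((a == i)%:R - (a == i.+1)%:R)
  = (if (a < m)%N then g a else 0) - (if (0 < a <= m)%N then g a.-1 else 0).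
Proof.
elim: m => [|m IH]; first by rewrite big_ord0; case: a.
rewrite big_ord_recr /= {}IH ltnS [(a <= m.+1)%N]leq_eqVlt ltnS.
have [->|ne1] := eqVneq a m.
  by rewrite ltnn leqnn /= (ltn_eqF (ltnSn m)) /=; case: m => [|m] /=; lia.
have [->|ne2] := eqVneq a m.+1; first by rewrite !ltnn ltnNge leqnSn /=; lia.
rewrite subrr mulr0 addr0 /= [(a <= m)%N]leq_eqVlt (negPf ne1) /=.
by [].
Qed.

(* The coefficient of alpha_i in 2 rho, the sum of the positive roots. *)
Definition two_rho (i : nat) : nat := (i.+1 * (r.*2.+1 - i))%N.

Lemma wform_two_rho (j : I) :
  \sum_(i : I) (two_rho i)%:Z * wform (alpha i) (alpha j) = 2.
Proof.
(* [D a] is the pairing of 2 rho with eps_a, namely 2r + 1 - 2a; consecutive values differ by 2. *)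
pose D (a : nat) : int := \sum_(i < r.*2.+1) (two_rho i)%:Z * ((a == i)%:R - (a == i.+1)%:R).
have DE a : (a <= r.*2.+1)%N -> D a = r.*2.+1%:Z - a.*2%:Z.
  move=> le_a; rewrite /D (sum_telescope (fun i => (two_rho i)%:Z)) le_a andbT /two_rho.
  case: a le_a => [|a] le_a /=; first lia.
  by case: ltnP => ?; nia.
transitivity (D j - D j.+1); last by rewrite !DE ?(ltnW (ltn_ord j)) //; lia.
rewrite -sumrB; apply: eq_bigr => i _; rewrite -mulrBr wform_alphar; congr (_ * _).
have inord_eq (a b : nat) : (a < r.*2.+2)%N -> (b < r.*2.+2)%N ->
    ((inord a : 'I_r.*2.+2) == inord b) = (a == b).
  by move=> la lb; rewrite -val_eqE /= !inordK.
have [li lj] := (ltn_ord i, ltn_ord j).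
by rewrite !mxE !eqxx /= !inord_eq // ltnS ltnW.
Qed.

Lemma wform_two_rho_root (mu : Qplus) :
  \sum_(i : I) (two_rho i)%:Z * wform (alpha i) (root_of mu) = (ht mu).*2%:Z.
Proof.
transitivity (\sum_(j : I) (mu j)%:Z * 2).
  under eq_bigr => i _ do rewrite /root_of wform_sumr mulr_sumr.
  rewrite exchange_big; apply: eq_bigr => j _; rewrite -(wform_two_rho j) mulr_sumr.
  by apply: eq_bigr => i _; rewrite mulrCA.
rewrite -mulr_suml /ht; have -> : \sum_i (mu i)%:Z = (\sum_i mu i)%N%:Z.
  by rewrite -natz natr_sum; apply: eq_bigr => i _; rewrite natz.
lia.
Qed.

Definition weight (mu : Qplus) (x : U) : Prop :=
  forall i : I, K_ i * x * KV_ i = q ^ (- wform (alpha i) (root_of mu)) *: x.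

Definition two_rho_seq : seq I := flatten [seq nseq (two_rho i) i | i : I <- enum I].

(* K_(2 rho) and its inverse: conjugation by them sees only the height. *)
Definition kappa : U := \prod_(i <- two_rho_seq) K_ i.
Definition kappaV : U := \prod_(i <- rev two_rho_seq) KV_ i.

(** The exponents of the nested conjugations add up to -(2 rho, mu), and 2 rho pairs to 2 with every
    simple root. *)
Lemma weight_kappa mu x : weight mu x -> kappa * x * kappaV = q ^- (ht mu).*2 *: x.
Proof.
move=> wx; have conjE s : \prod_(i <- s) K_ i * x * \prod_(i <- rev s) KV_ i
    = q ^ (- \sum_(i <- s) wform (alpha i) (root_of mu)) *: x.
  elim: s => [|i s IH]; first by rewrite !big_nil mulr1 mul1r oppr0 scale1r.
  rewrite !big_cons rev_cons -cats1 big_cat big_seq1 /=.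
  rewrite -!mulrA (mulrA (\prod_(j <- s) K_ j)) (mulrA _ _ (KV_ i)) IH.
  rewrite -scalerAl -scalerAr mulrA wx scalerA -expfzDr ?q_neq0 //.
  by rewrite opprD addrC.
rewrite /kappa /kappaV conjE exprnN; congr (q ^ (- _) *: _).
rewrite -wform_two_rho_root /two_rho_seq big_flatten big_map /= big_enum /=.
apply: eq_bigr => i _; rewrite big_nseq iter_addr_0 -mulr_natl natz.
by [].
Qed.

Definition content (s : seq I) : Qplus := [ffun i => count_mem i s].

Lemma ht_content s : ht (content s) = size s.
Proof.
rewrite /ht; under eq_bigr => i _ do rewrite ffunE.
elim: s => [|i s IH]; first by rewrite big1.
rewrite /= big_split /= IH (bigD1 i) //= eqxx big1 ?addn0 // => j /negPf.
by rewrite eq_sym => ->.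
Qed.

Definition qadd (mu nu : Qplus) : Qplus := [ffun i => mu i + nu i]%N.

Lemma ht_qadd mu nu : ht (qadd mu nu) = (ht mu + ht nu)%N.
Proof. by rewrite /ht -big_split; apply: eq_bigr => i _; rewrite ffunE. Qed.

Lemma root_of_qadd mu nu : root_of (qadd mu nu) = root_of mu + root_of nu.
Proof. by rewrite /root_of -big_split; apply: eq_bigr => i _; rewrite ffunE mulrnDr. Qed.

Lemma weightM mu nu x y : weight mu x -> weight nu y -> weight (qadd mu nu) (x * y).
Proof.
move=> wx wy i; rewrite root_of_qadd wformDr opprD expfzDr ?q_neq0 //.
rewrite -scalerA scalerAr -wy.
have -> : K_ i * (x * y) * KV_ i = (K_ i * x * KV_ i) * (K_ i * y * KV_ i).
  by rewrite !mulrA -[_ * KV_ i * K_ i]mulrA KV_K mulr1.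
by rewrite wx -scalerAl.
Qed.

Lemma weight_lin mu (x y : U) (c : Qq) : weight mu x -> weight mu y -> weight mu (c *: x + y).
Proof.
move=> wx wy i; rewrite mulrDr mulrDl -scalerAr -scalerAl wx wy.
by rewrite scalerDr !scalerA mulrC.
Qed.

Lemma weight1 : weight (mu0 r) 1.
Proof.
move=> i; rewrite mulr1 K_KV (_ : root_of _ = 0).
  by rewrite /wform trmx0 mulmx0 mxE oppr0 scale1r.
by rewrite /root_of big1 // => j _; rewrite ffunE mulr0n.
Qed.

Lemma weight_F j : weight (content [:: j]) (F_ j).
Proof.
move=> i; rewrite K_F_KV (_ : root_of _ = alpha j) // /root_of.
rewrite (bigD1 j) //= ffunE /= eqxx big1 => [|k /negPf]; first by rewrite addr0.
by rewrite ffunE /= eq_sym => ->.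
Qed.

Lemma weight_fword s : weight (content s) (fword s).
Proof.
elim: s => [|j s IH].
  rewrite /fword big_nil (_ : content _ = mu0 r); first exact: weight1.
  by apply/ffunP => i; rewrite !ffunE.
rewrite /fword big_cons (_ : content _ = qadd (content [:: j]) (content s)).
  by apply: weightM (weight_F j) IH.
by apply/ffunP => i; rewrite !ffunE /= addn0.
Qed.

Lemma fword_cat (s t : seq I) : fword s * fword t = fword (s ++ t).
Proof. by rewrite /fword big_cat. Qed.

Lemma Uminus_fword (s : seq I) : Uminus (fword s).
Proof.
elim: s => [|j s IH]; first by rewrite /fword big_nil -(scale1r 1); apply: subalg_scalar.
by rewrite /fword big_cons; apply: subalg_mul IH; apply: subalg_gen; exists j.
Qed.

Lemma Uplus_eword s : Uplus (@eword r s).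
Proof.
elim: s => [|j s IH]; first by rewrite /eword big_nil -(scale1r 1); apply: subalg_scalar.
by rewrite /eword big_cons; apply: subalg_mul IH; apply: subalg_gen; exists j.
Qed.

Lemma Uzero_kword s : Uzero (@kword r s).
Proof.
elim: s => [|k s IH]; first by rewrite /kword big_nil -(scale1r 1); apply: subalg_scalar.
rewrite /kword big_cons; apply: subalg_mul IH; apply: subalg_gen; exists k.2.
by rewrite /kgen; case: k.1; [left | right].
Qed.

(** The predicate on lengths lets all of U^-, its homogeneous pieces and its tails of large height
    share one product lemma. *)
Definition fspan (P : nat -> Prop) : U -> Prop :=
  lspan (fun x => exists2 s, x = fword s & P (size s)).

Lemma fspan_mul (P Q R : nat -> Prop) :
  (forall m n, P m -> Q n -> R (m + n)%N) ->
  forall x y, fspan P x -> fspan Q y -> fspan R (x * y).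
Proof.
move=> PQR; apply: lspan_mul => _ _ [s -> Ps] [t -> Qt].
by apply: lspan_gen; exists (s ++ t); rewrite ?fword_cat // size_cat; apply: PQR.
Qed.

Lemma fspan_sub (P Q : nat -> Prop) :
  (forall n, P n -> Q n) -> forall x, fspan P x -> fspan Q x.
Proof.
by move=> PQ; apply: lspan_sup => _ [s -> Ps]; apply: lspan_gen; exists s => //; apply: PQ.
Qed.

Lemma Uminus_fspan x : Uminus x -> fspan xpredT x.
Proof.
elim=> {x} [_ [i ->]|c|x y _ Tx _ Ty|x y _ Tx _ Ty].
- by apply: lspan_gen; exists [:: i]; rewrite // /fword big_seq1.
- by apply/lspan_scale/lspan_gen; exists [::]; rewrite // /fword big_nil.
- exact: lspan_add.
- exact: fspan_mul Tx Ty.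
Qed.

Lemma fspan_Uminus P x : fspan P x -> Uminus x.
Proof.
elim=> [|c _ y [s -> _] _ My]; first by rewrite -(scale0r 1); apply: subalg_scalar.
apply: subalg_add My; rewrite -[fword s]mul1r scalerAl.
by apply: subalg_mul (Uminus_fword s); apply: subalg_scalar.
Qed.

Lemma fspan_kappa n x : fspan (eq n) x -> kappa * x * kappaV = q ^- n.*2 *: x.
Proof.
move=> Tx; apply/eqP; rewrite -subr_eq0; apply/eqP.
apply: (@lspan_zero _ _ _ (fun x => kappa * x * kappaV - q ^- n.*2 *: x)) Tx => [c u v|_ [s -> ->]].
  rewrite mulrDr mulrDl scalerBr scalerDr -scalerAr -scalerAl !scalerA [_ / _]mulrC.
  by rewrite opprD addrACA.
by rewrite (weight_kappa (weight_fword s)) ht_content subrr.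
Qed.

(* A weight vector of U^- is a combination of words in the F_i of the right
   length: the height components are eigenvectors of conjugation by K_(2 rho)
   for distinct eigenvalues. *)
Lemma Uminus_wt_fspan mu x : Uminus_wt mu x -> fspan (eq (ht mu)) x.
Proof.
case=> /Uminus_fspan Tx /weight_kappa kx.
have [n [v [Tv xE]]] : exists n (v : nat -> U),
    (forall i, fspan (eq i) (v i)) /\ forall m, (n <= m)%N -> x = \sum_(i < m) v i.
  elim: Tx {kx} => [|c _ y [s -> _] _ [n [v [Tv yE]]]].
    by exists 0%N, (fun=> 0); split=> [i|m _]; [apply: lspan0 | rewrite big1].
  exists (maxn n (size s).+1), (fun i => (if i == size s then c *: fword s else 0) + v i).
  split=> [i|m].
    apply: lspan_add (Tv i); case: eqP => [->|_]; last exact: lspan0.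
    by apply/lspan_scale/lspan_gen; exists s.
  rewrite geq_max => /andP[le_nm ls]; rewrite big_split /= -yE //; congr (_ + _).
  by rewrite (bigD1 (Ordinal ls)) //= eqxx big1 ?addr0 // => j; rewrite -val_eqE => /negPf->.
(* Subtracting [x] from the component of height [h] turns the decomposition of [x] into a vanishing
   sum of eigenvectors, so [x] equals that component. *)
set h := ht mu in kx *; pose w i := v i - if i == h then x else 0.
have kw i : kappa * w i * kappaV = q ^- i.*2 *: w i.
  rewrite /w mulrBr mulrBl (fspan_kappa (Tv i)) scalerBr; congr (_ - _).
  by case: eqP => [->|_]; rewrite ?kx // mulr0 mul0r scaler0.
have sum_w : \sum_(i < maxn n h.+1) w i = 0.
  rewrite sumrB -xE ?leq_maxl // (bigD1 (Ordinal (leq_maxr n h.+1))) //= eqxx.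
  by rewrite big1 ?addr0 ?subrr // => j; rewrite -val_eqE => /negPf->.
have linA : linear (fun y : U => kappa * y * kappaV).
  by move=> c y z; rewrite mulrDr mulrDl -scalerAr -scalerAl.
have /eqP := eigenvectors_independent linA qXV_inj (fun i _ => kw i) sum_w (leq_maxr n h.+1).
by rewrite /w eqxx subr_eq0 => /eqP <-.
Qed.

End Weights.

(** * The ideals that define the completion *)

Section CompletionIdeals.
Variable r : nat.
Local Notation I := 'I_r.*2.+1.
Local Notation U := (U r).
Local Notation Qplus := (Qplus r).

(* By the triangular decomposition this is the same space as [Jideal N]; in
   this form it is visibly a left ideal. *)
Definition lideal (N : nat) : U -> Prop :=
  lspan (fun x => exists y s, x = y * fword s /\ (N <= size s)%N).

(** In one direction the weight component is expanded into words whose length is its height. In the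
    other the left factor is decomposed and its F-word is absorbed into the given one, which only
    lengthens it. *)
Lemma Jideal_lideal N (x : U) : Jideal N x <-> lideal N x.
Proof.
split; apply: lspan_sup => {}x.
  case=> a [b [c [mu [_ _ /Uminus_wt_fspan Tc le_N ->]]]].
  apply: (@lspan_lin _ _ _ _ ( *%R (a * b))) Tc => [k u v|_ [s -> hts]].
    by rewrite mulrDr scalerAr.
  by apply: lspan_gen; exists (a * b), s; rewrite -hts.
case=> y [w [-> le_N]].
apply: (@lspan_lin _ _ _ _ ( *%R^~ (fword w))) (triangular_decomposition y) => [k u v|].
  by rewrite mulrDl scalerAl.
move=> _ [s [t [w' ->]]] /=; rewrite -[_ * fword w]mulrA fword_cat.
apply: lspan_gen; exists (eword s), (kword t), (fword (w' ++ w)), (content (w' ++ w)).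
split=> //; [exact: Uplus_eword|exact: Uzero_kword| |].
  by split; [apply: Uminus_fword|apply: weight_fword].
by rewrite ht_content size_cat; lia.
Qed.

Lemma lideal_le M N x : (M <= N)%N -> lideal N x -> lideal M x.
Proof.
move=> le_MN; apply: lspan_sup => _ [y [s [-> le_s]]].
by apply: lspan_gen; exists y, s; rewrite (leq_trans le_MN).
Qed.

Lemma lidealMl N u x : lideal N x -> lideal N (u * x).
Proof.
apply: lspan_lin => [k v w|_ [y [s [-> le_s]]]]; first by rewrite mulrDr scalerAr.
by apply: lspan_gen; exists (u * y), s; rewrite mulrA.
Qed.

Lemma fspan_lideal (P : nat -> Prop) N x :
  (forall n, P n -> (N <= n)%N) -> fspan P x -> lideal N x.
Proof.
move=> PN; apply: lspan_sup => _ [s -> Ps]; apply: lspan_gen; exists 1, s.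
by rewrite mul1r PN.
Qed.

Lemma lidealM_fspan m N x y :
  lideal N x -> fspan (fun n => (m <= n)%N) y -> lideal (N + m) (x * y).
Proof.
apply: lspan_mul => _ _ [z [s [-> le_s]]] [t -> le_t].
by apply: lspan_gen; exists z, (s ++ t); rewrite -fword_cat mulrA size_cat leq_add.
Qed.

Lemma lideal_fword N (s : seq I) : (N <= size s)%N -> lideal N (fword s).
Proof. by move=> le_s; apply: lspan_gen; exists 1, s; rewrite mul1r. Qed.

Lemma lidealM_fword N (u : U) d :
    (forall s : seq I, (N + d <= size s)%N -> lideal N (fword s * u)) ->
  forall x, lideal (N + d) x -> lideal N (x * u).
Proof.
move=> Hu x; apply: (lspan_lin (f := *%R^~ u)) => [k v w|_ [y [s [-> le_s]]]].
  by rewrite mulrDl scalerAl.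
by rewrite -mulrA; apply/lidealMl/Hu.
Qed.

Lemma fword_kgen_lideal N k (s : seq I) : (N <= size s)%N -> lideal N (fword s * kgen k).
Proof.
move=> le_s; have [c ->] := fword_kgen s k.
by apply/lspan_scale/lidealMl/lideal_fword.
Qed.

(** As E_j moves left through the word, each commutator replaces one letter by a combination of
    K^(+-1), which passes the remaining letters up to a scalar; hence the loss of one letter. *)
Lemma fword_E_lideal N j (s : seq I) : (N < size s)%N -> lideal N (fword s * E_ j).
Proof.
elim/last_ind: s N => // s i IH N; rewrite size_rcons ltnS => le_s.
rewrite -cats1 -fword_cat /fword (big_seq1 _ i) -/(fword s) -mulrA.
have -> : F_ i * E_ j = E_ j * F_ i
     - ((j == i)%:R / (q - q^-1)) *: (kgen (true, j) - kgen (false, j)).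
  by rewrite -E_F_comm opprB addrC subrK.
rewrite mulrBr -scalerAr mulrBr; apply: lspan_sub; last first.
  by apply/lspan_scale/lspan_sub; apply: fword_kgen_lideal.
(* For [N = 0] the ideal is everything, by the empty word. *)
case: N le_s => [|N] le_s.
  by apply: lspan_gen; exists (fword s * (E_ j * F_ i)), [::]; rewrite /fword big_nil mulr1.
rewrite mulrA -[N.+1]addn1; apply: lidealM_fspan (IH _ le_s) _.
by apply: lspan_gen; exists [:: i]; rewrite // /fword big_seq1.
Qed.

(** Continuity of right multiplication: each E costs one letter, F and K cost none; costs add along
    products, and a sum takes the larger one. *)
Lemma lidealMr (u : U) : exists d, forall N x, lideal (N + d) x -> lideal N (x * u).
Proof.
elim/U_ind: u => [i|i|i|i|c|x y [d Hx] [e Hy]|x y [d Hx] [e Hy]].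
- by exists 1%N => N; apply: lidealM_fword => s; rewrite addn1; apply: fword_E_lideal.
- exists 0%N => N; apply: lidealM_fword => s; rewrite addn0 => le_s.
  have -> : F_ i = fword [:: i] by rewrite /fword big_seq1.
  by rewrite fword_cat; apply: lideal_fword; rewrite size_cat ltnW // addn1.
- exists 0%N => N; apply: lidealM_fword => s; rewrite addn0.
  exact: (@fword_kgen_lideal _ (true, i)).
- exists 0%N => N; apply: lidealM_fword => s; rewrite addn0.
  exact: (@fword_kgen_lideal _ (false, i)).
- by exists 0%N => N x; rewrite addn0 -scalerAr mulr1; apply: lspan_scale.
- exists (maxn d e) => N z Jz; rewrite mulrDr.
  by apply: lspan_add; [apply: Hx | apply: Hy]; apply: lideal_le Jz;
     rewrite leq_add2l ?leq_maxl ?leq_maxr.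
- exists (e + d)%N => N z; rewrite addnA mulrA => Jz; exact/Hy/Hx.
Qed.

Variables (psi : U -> U) (hpsi : is_bar_U psi).

(** [barq] is computed on a chosen representative, so these laws are not visible from its
    definition. They are read off from the antilinear [psi] on multiples of 1, which is nonzero in
    U. *)
Lemma barq_morph :
  [/\ barq 1 = 1, {morph barq : a b / a * b} & psi 0 = 0].
Proof.
have [[anti psi1 psiM psiK] _] := hpsi.
have one0 : (1 : U) != 0 by apply: oner_neq0.
have inj c d : c *: (1 : U) = d *: 1 -> c = d.
  by move/eqP; rewrite -subr_eq0 -scalerBl scaler_eq0 (negPf one0) orbF subr_eq0 => /eqP.
have psi0 : psi 0 = 0.
  have b1 : barq 1 *: psi 0 = 0.
    by apply: (addIr (psi 0)); rewrite -anti scale1r addr0 add0r.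
  (* If [barq 1] were 0, [psi] would ignore the first summand, and psi(1 + 0) = psi(0) would
     contradict injectivity. *)
  have [b0|] := eqVneq (barq 1) 0; last first.
    by move=> b0; apply/eqP; move/eqP: b1; rewrite scaler_eq0 (negPf b0).
  have cst x y : psi (x + y) = psi y by rewrite -[x]scale1r anti b0 scale0r add0r.
  case/eqP: one0; apply: (inv_inj psiK).
  by rewrite -[1 in LHS]addr0; apply: cst.
have psiZ c x : psi (c *: x) = barq c *: psi x by rewrite -[c *: x]addr0 anti psi0 addr0.
split=> // [|a b]; apply: inj.
  by rewrite -[in LHS]psi1 -psiZ !scale1r.
by rewrite -[in LHS]psi1 -psiZ -scalerA -[in RHS]psi1 -scalerA -!psiZ.
Qed.

(** Multiplicativity makes [barq q] invertible, which supplies the hypothesis of [barq_q]. *)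
Lemma barq_exp (m : int) : barq (q ^ m) = q ^ (- m).
Proof.
have [b1 bM _] := barq_morph.
have bV : barq q * barq q^-1 = 1 by rewrite -bM divff ?q_neq0.
have bq : barq q = q^-1.
  by apply: barq_q; apply: contra_eq_neq bV => ->; rewrite mul0r eq_sym oner_neq0.
have bqV : barq q^-1 = q.
  by apply: (mulfI (invr_neq0 q_neq0)); rewrite -{1}bq bV mulVf ?q_neq0.
have bX x n : barq (x ^+ n) = barq x ^+ n.
  by elim: n => [|n IH]; rewrite ?expr0 // !exprS bM IH.
case: m => n; first by rewrite -exprnP bX bq exprVn exprnN.
by rewrite NegzE opprK -exprnN -exprVn bX bqV.
Qed.

Lemma psi_add x y : psi (x + y) = psi x + psi y.
Proof.
have [b1 _ _] := barq_morph; have [[anti _ _ _] _] := hpsi.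
by rewrite -[x in LHS]scale1r anti b1 scale1r.
Qed.

Lemma psi_sub x y : psi (x - y) = psi x - psi y.
Proof. by apply/eqP; rewrite eq_sym subr_eq -psi_add subrK. Qed.

Lemma psi_sum (J : Type) (s : seq J) (P : pred J) (f : J -> U) :
  psi (\sum_(j <- s | P j) f j) = \sum_(j <- s | P j) psi (f j).
Proof. by have [_ _ psi0] := barq_morph; exact: (big_morph psi psi_add psi0). Qed.

Lemma psi_lspan (S T : U -> Prop) :
  (forall x, S x -> lspan T (psi x)) -> forall x, lspan S x -> lspan T (psi x).
Proof.
have [_ _ psi0] := barq_morph; have [[anti _ _ _] _] := hpsi.
move=> ST x; elim=> [|c u v Su _ IH]; first by rewrite psi0; apply: lspan0.
by rewrite anti; apply/lspan_add/IH/lspan_scale/ST.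
Qed.

Lemma psi_fword s : psi (fword s) = fword s.
Proof.
have [[_ psi1 psiM _] gens] := hpsi.
elim: s => [|i s IH]; rewrite /fword ?big_nil ?big_cons // psiM IH.
by have [_ -> _] := gens i.
Qed.

(** [psi] fixes the F-words, so it is continuous and may be applied to congruences modulo the
    ideals. *)
Lemma psi_lideal N x : lideal N x -> lideal N (psi x).
Proof.
have [[_ _ psiM _] _] := hpsi.
apply: psi_lspan => _ [y [s [-> le_s]]]; rewrite psiM psi_fword.
by apply: lspan_gen; exists (psi y), s.
Qed.

(** [psi] inverts both K_i and the power of q in the weight relation; conjugating by K_i then
    restores the original relation. *)
Lemma psi_Uminus_wt mu x : Uminus_wt mu x -> Uminus_wt mu (psi x).
Proof.
have [[anti psi1 psiM psiK] gens] := hpsi; have [_ _ psi0] := barq_morph.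
have psiZ c y : psi (c *: y) = barq c *: psi y by rewrite -[c *: y]addr0 anti psi0 addr0.
move=> wx; split.
  apply: (@fspan_Uminus r (fun=> True)) (psi_lspan _ (Uminus_fspan wx.1)) => _ [s -> _].
  by rewrite psi_fword; apply: lspan_gen; exists s.
have gensK i : psi (K_ i) = KV_ i by have [_ _] := gens i.
move=> i; have := congr1 psi (wx.2 i); rewrite !psiM psiZ barq_exp opprK.
have psiKVi : psi (KV_ i) = K_ i by rewrite -gensK psiK.
rewrite gensK psiKVi => Kx; rewrite -[psi x in LHS]scale1r.
have -> : 1 = q ^ (- wform (alpha i) (root_of mu)) * q ^ wform (alpha i) (root_of mu).
  by rewrite -expfzDr ?q_neq0 // addNr.
rewrite -scalerA -Kx -scalerAr -scalerAl !mulrA K_KV mul1r -!mulrA K_KV mulr1.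
by [].
Qed.

End CompletionIdeals.

(** * Convolution in the completion *)

Section Convolution.
Variable r : nat.
Local Notation I := 'I_r.*2.+1.
Local Notation U := (U r).
Local Notation Qplus := (Qplus r).
Implicit Types (mu nu : Qplus) (X Z : Qplus -> U).

(** Coordinates of an element of height below [n] are themselves below [n], so the functions into
    ['I_n] reach all of them. This turns sums over a set into finite sums over a sequence. *)
Definition below (n : nat) : seq Qplus :=
  [seq mu <- [seq ([ffun i => val (f i)] : Qplus) | f : {ffun I -> 'I_n}] | (ht mu < n)%N].

Lemma le_ht mu i : (mu i <= ht mu)%N.
Proof. by rewrite /ht (bigD1 i) //= leq_addr. Qed.

Lemma mem_below n mu : (mu \in below n) = (ht mu < n)%N.
Proof.
rewrite mem_filter andb_idr // => lt_n; apply/mapP.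
exists [ffun i => Ordinal (leq_ltn_trans (le_ht mu i) lt_n)]; first exact: mem_enum.
by apply/ffunP => i; rewrite !ffunE.
Qed.

Lemma below_uniq n : uniq (below n).
Proof.
rewrite filter_uniq // map_inj_uniq ?enum_uniq // => f g /ffunP fg.
by apply/ffunP => i; apply: val_inj; have := fg i; rewrite !ffunE.
Qed.

Lemma compl_sumE X n : compl_sum X n = \sum_(mu <- below n) X mu.
Proof.
rewrite fsbig_seq ?below_uniq //; apply: eq_fsbigl.
by apply/seteqP; split=> mu /=; rewrite mem_below.
Qed.

Definition qle nu mu : bool := [forall i, (nu i <= mu i)%N].
Definition qsub mu nu : Qplus := [ffun i => mu i - nu i]%N.

Lemma qaddK nu mu : qsub (qadd nu mu) nu = mu.
Proof. by apply/ffunP => i; rewrite !ffunE addKn. Qed.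

Lemma qsubK nu mu : qle nu mu -> qadd nu (qsub mu nu) = mu.
Proof. by move/forallP => le_nm; apply/ffunP => i; rewrite !ffunE subnKC. Qed.

Lemma qle_qadd nu mu : qle nu (qadd nu mu).
Proof. by apply/forallP => i; rewrite ffunE leq_addr. Qed.

Lemma qle_ht nu mu : qle nu mu -> (ht nu <= ht mu)%N.
Proof. by move/forallP => le_nm; apply: leq_sum. Qed.

(** The component of degree [mu] in the product of two formal sums. The height bound loses nothing,
    since [qle nu mu] bounds the height of [nu]. *)
Definition conv X Z mu : U :=
  \sum_(nu <- below (ht mu).+1 | qle nu mu) X nu * Z (qsub mu nu).

Lemma convE X Z mu n : (ht mu < n)%N ->
  conv X Z mu = \sum_(nu <- below n | qle nu mu) X nu * Z (qsub mu nu).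
Proof.
move=> lt_n; rewrite /conv -big_filter -[RHS]big_filter; apply: perm_big.
apply: uniq_perm; rewrite 1?filter_uniq ?below_uniq // => nu.
rewrite !(mem_filter (qle^~ mu)) !mem_below; case: (boolP (qle nu mu)) => //= /qle_ht le_nm.
by rewrite ltnS le_nm (leq_ltn_trans le_nm lt_n).
Qed.

(** The product of two truncations exceeds the truncated product exactly by the pairs of total
    height at least [n]. *)
Lemma sum_conv X Z n :
  compl_sum X n * compl_sum Z n = compl_sum (conv X Z) n +
    \sum_(nu <- below n) \sum_(ka <- below n | (n <= ht nu + ht ka)%N) X nu * Z ka.
Proof.
rewrite !compl_sumE big_distrl /=.
have -> : \sum_(mu <- below n) conv X Z mu = \sum_(nu <- below n)
    \sum_(ka <- below n | (ht nu + ht ka < n)%N) X nu * Z ka.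
  transitivity (\sum_(mu <- below n) \sum_(nu <- below n | qle nu mu) X nu * Z (qsub mu nu)).
    by apply: eq_big_seq => mu; rewrite mem_below; apply: convE.
  rewrite (exchange_big_dep xpredT) //=; apply: eq_big_seq => nu; rewrite mem_below => lt_nu.
  (* Reindexing by mu = nu + ka. *)
  rewrite -big_filter (perm_big [seq qadd nu ka | ka <- below n & (ht nu + ht ka < n)%N]).
    by rewrite big_map big_filter; apply: eq_bigr => ka _; rewrite qaddK.
  apply: uniq_perm; rewrite 1?filter_uniq ?below_uniq //.
    rewrite map_inj_uniq 1?filter_uniq ?below_uniq // => ka ka' eq_ka.
    by rewrite -(qaddK nu ka) eq_ka qaddK.
  move=> mu; rewrite mem_filter mem_below; apply/andP/mapP => [[le_nm lt_mu]|[ka]].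
    exists (qsub mu nu); last by rewrite qsubK.
    rewrite mem_filter mem_below -ht_qadd qsubK // lt_mu /=.
    by apply: leq_ltn_trans lt_mu; apply: leq_sum => i _; rewrite ffunE leq_subr.
  by rewrite mem_filter mem_below -ht_qadd => /andP[lt_ka _] ->; rewrite qle_qadd.
rewrite -big_split; apply: eq_bigr => nu _ /=; rewrite mulr_sumr.
rewrite (bigID (fun ka => ht nu + ht ka < n)%N) /=; congr (_ + _).
by apply: eq_bigl => ka; rewrite -leqNgt.
Qed.

Definition graded X := forall mu, Uminus_wt mu (X mu).

Lemma graded_fspan X n : graded X -> fspan xpredT (compl_sum X n).
Proof.
by move=> gX; rewrite compl_sumE; apply: lspan_sum => mu _; apply/Uminus_fspan/(gX mu).1.
Qed.

Lemma graded_conv X Z : graded X -> graded Z -> graded (conv X Z).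
Proof.
move=> gX gZ mu; split.
  rewrite /conv; apply: big_ind => [|x y|nu _].
  - by rewrite -(scale0r 1); apply: subalg_scalar.
  - exact: subalg_add.
  - by apply: subalg_mul; [apply: (gX nu).1 | apply: (gZ _).1].
suff : weight mu (conv X Z mu) by [].
rewrite /conv; apply: big_ind => [|x y wx wy|nu le_nm].
- by move=> i; rewrite mulr0 mul0r scaler0.
- by rewrite -[x]scale1r; apply: weight_lin.
- by rewrite -[mu in weight mu](qsubK le_nm); apply: weightM; [apply: (gX nu).2 | apply: (gZ _).2].
Qed.

Lemma conv_mu0 X Z : X (mu0 r) = 1 -> Z (mu0 r) = 1 -> conv X Z (mu0 r) = 1.
Proof.
move=> X0 Z0; rewrite /conv -big_filter (perm_big [:: mu0 r]).
  rewrite big_seq1 X0 mul1r -[RHS]Z0; congr Z.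
  by apply/ffunP => i; rewrite !ffunE.
apply: uniq_perm; rewrite 1?filter_uniq ?below_uniq // => nu.
rewrite mem_filter mem_below inE; apply/andP/eqP => [[/forallP le_nu _]|->].
  by apply/ffunP => i; have := le_nu i; rewrite !ffunE leqn0 => /eqP.
by split=> //; apply/forallP.
Qed.

Lemma fspan_graded_tail X Z n : graded X -> graded Z ->
  fspan (fun k => (n <= k)%N)
    (\sum_(nu <- below n) \sum_(ka <- below n | (n <= ht nu + ht ka)%N) X nu * Z ka).
Proof.
move=> gX gZ; apply: lspan_sum => nu _; apply: lspan_sum => ka le_n.
by apply: (@fspan_mul r _ _ (leq n) _ _ _ (Uminus_wt_fspan (gX nu)) (Uminus_wt_fspan (gZ ka)))
  => _ _ <- <-.
Qed.

(** Both errors from [sum_conv] are spanned by words of length at least [n], so the product of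
    partial sums represents the triple convolution in the completion. *)
Lemma sum_conv3 X1 X2 X3 n : graded X1 -> graded X2 -> graded X3 ->
  fspan (leq n) (compl_sum X1 n * compl_sum X2 n * compl_sum X3 n
                 - compl_sum (conv (conv X1 X2) X3) n).
Proof.
move=> g1 g2 g3; rewrite sum_conv mulrDl sum_conv addrAC (addrC (compl_sum _ n)) addrK.
apply: lspan_add; first by apply: fspan_graded_tail => //; apply: graded_conv.
apply: (@fspan_mul r _ _ (leq n) _ _ _ (fspan_graded_tail n g1 g2) (graded_fspan n g3)).
move=> k m le_nk _.
exact: leq_trans le_nk (leq_addr _ _).
Qed.

End Convolution.

(** * The intertwiner built from Y and its bar conjugate *)

Section Intertwiner.
Variables (r : nat) (psi : U r -> U r) (psii : Ui r -> Ui r).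
Hypotheses (hpsi : is_bar_U psi) (hpsii : is_bar_Ui psii).

Lemma Upsilon_spec_conj Y : Upsilon_spec psi psii Y ->
  Upsilon_spec psi psii (conv (conv Y (psi \o Y)) Y).
Proof.
case=> gY Y0 intY; have [[_ psi1 psiM psiK] _] := hpsi.
have gpY : graded (psi \o Y) by move=> mu; apply: psi_Uminus_wt.
split; first by do !apply: graded_conv.
  by do !apply: conv_mu0; rewrite //= Y0.
move=> u N; set v := val (psii u); set w := psi (val u).
(* The relation for [psii u], conjugated by [psi], becomes the congruence between w psi(Y) and
   psi(Y) v, because [psii] is an involution. *)
have [n1 Hn1] := intY u N; have [n2 Hn2] := intY (psii u) N.
have [d Hd] := lidealMr w.
(* The truncation error [R] lies only in [lideal n], and right multiplication by [w] may cost
   [d]. *)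
exists (maxn (maxn n1 n2) (N + d)) => n; rewrite !geq_max => /andP[/andP[le1 le2] le3].
apply/Jideal_lideal.
have /Jideal_lideal := Hn1 n le1; have /Jideal_lideal := Hn2 n le2.
have [[_ _ _ psiiK] _ _] := hpsii; rewrite psiiK -/v -/w.
set S := compl_sum Y n; set T := psi S.
have TE : compl_sum (psi \o Y) n = T by rewrite /T /S !compl_sumE psi_sum.
move=> /(psi_lideal hpsi); rewrite psi_sub // !psiM psiK -/T -/w => D2 D1.
have TS : fspan (fun k => 0 <= k)%N S by apply: fspan_sub (graded_fspan n gY).
have TT : fspan (fun k => 0 <= k)%N T.
  by rewrite -TE; apply: fspan_sub (graded_fspan n gpY).
have := sum_conv3 n gY gpY gY; rewrite TE -/S.
set S' := compl_sum (conv _ _) n; set R := _ - S' => FR.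
have LR : lideal n R by apply: fspan_lideal FR.
(* Telescoping: [v] passes the three factors of S T S one at a time, becoming [w], then [v], then
   [w]; the last two terms correct for S' = S T S - R. *)
have -> : v * S' - S' * w = (v * S - S * w) * (T * S) + S * (w * T - T * v) * S
    + S * T * (v * S - S * w) - v * R + R * w.
  have -> : S' = S * T * S - R by rewrite /R opprB addrC subrK.
  move: R {FR LR} => R; rewrite !(mulrBl, mulrBr) !mulrA.
  move: (v * _ * _ * _) (S * w * _ * _) (S * T * v * _) (S * T * S * w) (v * R) (R * w).
  by move=> a b c e f g; rewrite !subrKA opprB addrA addrAC; congr (_ + _); apply: addrAC.
have TST : fspan (fun k => 0 <= k)%N (T * S) by apply: (fspan_mul _ TT TS).
apply: lspan_add; last by apply/Hd/lideal_le/LR.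
apply: lspan_sub; last by apply/lidealMl/lideal_le/LR/(leq_trans (leq_addr _ _) le3).
apply: lspan_add; last exact: lidealMl.
apply: lspan_add; first by have := lidealM_fspan D1 TST; rewrite addn0.
by have := lidealM_fspan (lidealMl S D2) TS; rewrite addn0.
Qed.

End Intertwiner.

(** * Finite-dimensional modules *)

Section FiniteDimensionalModules.
Variables (r : nat) (M : vectType Qq) (rho : U r -> 'End(M)).
Hypothesis rho_mod : is_module rho.

Lemma rho_comp x y m : rho (x * y) m = rho x (rho y m).
Proof. by have [_ _ ->] := rho_mod; rewrite comp_lfunE. Qed.

Lemma rho0 : rho 0 = 0.
Proof.
have [lin _ _] := rho_mod; apply: (addrI (rho 0)).
by have := lin 1 0 0; rewrite !scale1r !addr0.
Qed.

Lemma rhoD x y : rho (x + y) = rho x + rho y.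
Proof. by have [lin _ _] := rho_mod; have := lin 1 x y; rewrite !scale1r. Qed.

Lemma rhoZ c x : rho (c *: x) = c *: rho x.
Proof. by have [lin _ _] := rho_mod; have := lin c x 0; rewrite rho0 !addr0. Qed.

Lemma rhoB x y : rho (x - y) = rho x - rho y.
Proof. by rewrite rhoD -scaleN1r rhoZ scaleN1r. Qed.

(* The prefixes of a word acting nontrivially act by eigenvectors of
   conjugation by K_(2 rho), for distinct eigenvalues. *)
Lemma rho_fword_eq0 s : (\dim {:'End(M)} <= size s)%N -> rho (fword s) = 0.
Proof.
have [_ _ rhoM] := rho_mod => le_s; apply/eqP; apply: contraLR le_s => s_neq0.
rewrite -ltnNge; pose v k := rho (fword (take k s)).
have v_neq0 k : v k != 0.
  apply: contraNneq s_neq0; rewrite /v => v0.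
  by rewrite -(cat_take_drop k s) -fword_cat rhoM v0 comp_lfun0l.
pose A (f : 'End(M)) : 'End(M) := (rho (kappa r) \o f \o rho (kappaV r))%VF.
have linA : linear A.
  by move=> c f g; rewrite /A comp_lfunDr comp_lfunDl -comp_lfunZr -comp_lfunZl.
have Av k : (k <= size s)%N -> A (v k) = q ^- k.*2 *: v k.
  move=> le_k; rewrite /A /v -!rhoM (weight_kappa (weight_fword _)) rhoZ.
  by rewrite ht_content size_takel.
(* The empty prefix counts too, giving [(size s).+1] independent operators; so [size s] is below the
   dimension. *)
have /eqP fr : free [tuple v k | k < (size s).+1].
  apply/freeP => c sum0 i; pose c' k := if insub k is Some j then c j else 0.
  have c'E (j : 'I_(size s).+1) : c' j = c j by rewrite /c' valK.
  have /eqP : c' i *: v i = 0.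
    apply: (eigenvectors_independent (v := fun k => c' k *: v k) linA qXV_inj) (ltn_ord i).
      move=> k lt_k; pose A' : {linear _ -> _} := HB.pack A (GRing.isLinear.Build _ _ _ _ A linA).
      by rewrite [LHS](linearZ_LR A') /= Av // !scalerA mulrC.
    rewrite -[RHS]sum0; apply: eq_bigr => j _.
    by rewrite c'E -tnth_nth tnth_mktuple.
  by rewrite scaler_eq0 c'E (negPf (v_neq0 i)) orbF => /eqP.
by have := dimvS (subvf <<[tuple v k | k < (size s).+1]>>); rewrite fr size_tuple.
Qed.

Let N0 := \dim {:'End(M)}.

Lemma rho_lideal_eq0 x : lideal N0 x -> rho x = 0.
Proof.
have [lin _ rhoM] := rho_mod; apply: (lspan_zero lin) => _ [y [s [-> le_s]]].
by rewrite rhoM rho_fword_eq0 // comp_lfun0r.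
Qed.

(** Components of height at least [N0] act by 0, so the sum over all mu is any partial sum past that
    height. *)
Lemma compl_actE Y n m : graded Y -> (N0 <= n)%N -> compl_act rho Y m = rho (compl_sum Y n) m.
Proof.
move=> gY le_n; rewrite compl_sumE.
have -> : rho (\sum_(mu <- below r n) Y mu) m = \sum_(mu <- below r n) rho (Y mu) m.
  rewrite (big_morph rho rhoD rho0) sum_lfunE.
  by [].
rewrite fsbig_seq ?below_uniq //; apply/esym/fsbig_widen => // mu [_ /=].
rewrite mem_below => /negP; rewrite -leqNgt => le_mu.
rewrite rho_lideal_eq0 ?zero_lfunE //; apply: fspan_lideal (Uminus_wt_fspan (gY mu)) => _ <-.
exact: leq_trans le_n le_mu.
Qed.

(* Y acts by 1 plus a nilpotent operator, so it can be cancelled. *)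
Lemma rho_compl_sum_cancel Y n x : graded Y -> Y (mu0 r) = 1 ->
  (0 < n)%N -> rho (x * compl_sum Y n) = 0 -> rho x = 0.
Proof.
move=> gY Y0 n_gt0 rho0x; have [_ _ rhoM] := rho_mod.
set y := compl_sum Y n - 1.
have Fy : fspan (fun k => 1 <= k)%N y.
  rewrite /y compl_sumE (bigD1_seq (mu0 r)) ?below_uniq //=; last first.
    by rewrite mem_below /ht big1 // => i _; rewrite ffunE.
  rewrite Y0 [1 + _]addrC addrK; apply: lspan_sum => mu mu_neq0.
  apply: (@fspan_sub r (eq (ht mu)) (leq 1) _ _ (Uminus_wt_fspan (gY mu))) => _ <-.
  rewrite lt0n; apply: contra mu_neq0; rewrite /ht sum_nat_eq0 => /forallP mu0_.
  by apply/eqP/ffunP => i; rewrite ffunE; apply/eqP; have := mu0_ i.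
(* Since x (1 + y) acts by 0, [x] acts as [x * - y], and iterating pushes it into ever deeper
   ideals. *)
have xyk k : rho x = rho (x * (- y) ^+ k).
  elim: k => [|k IH]; first by rewrite mulr1.
  have xy : x * - y = x - x * compl_sum Y n by rewrite /y opprB mulrBr mulr1.
  rewrite IH exprS mulrA xy mulrBl rhoB //.
  by rewrite [X in _ - X]rhoM rho0x comp_lfun0l subr0.
rewrite (xyk N0); apply/rho_lideal_eq0/lidealMl.
have Fk k : lideal k ((- y) ^+ k).
  elim: k => [|k IH].
    have -> : (- y) ^+ 0 = fword [::] by rewrite /fword big_nil.
    exact: lideal_fword.
  rewrite exprSr -addn1; apply: lidealM_fspan IH _.
  by rewrite -scaleN1r; apply: lspan_scale.
exact: Fk.
Qed.

End FiniteDimensionalModules.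

(** * The bar involution on the restricted module *)

Theorem proposition3p10 (r : nat)
    (psiU : U r -> U r) (hpsiU : is_bar_U psiU)
    (psiUi : Ui r -> Ui r) (hpsiUi : is_bar_Ui psiUi)
    (Upsilon : Qplus r -> U r) (hUpsilon : is_Upsilon psiU psiUi Upsilon)
    (M : vectType Qq) (rho : U r -> 'End(M)) (psi : M -> M)
    (hM : involutive_module psiU rho psi) :
  involutive_module psiUi (restrict_Ui rho)
    (fun m : M => compl_act rho Upsilon (psi m)).
Proof.
have [specY uniqY] := hUpsilon; have [gY Y0 intY] := specY.
have [rho_mod anti psiK rho_psi] := hM; have [lin rho1 rhoM] := rho_mod.
set N0 := \dim {:'End(M)}; pose S n := compl_sum Upsilon n.
have actE n m : (N0 <= n)%N -> compl_act rho Upsilon m = rho (S n) m by apply: compl_actE.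
split.
- split=> [c u v|| u v]; rewrite /restrict_Ui.
  + by rewrite -lin linearD linearZ.
  + by rewrite rmorph1.
  + by rewrite rmorphM.
- by move=> c x y; rewrite !(actE N0) // anti linearD linearZ.
- move=> m; have [n1 Hn1] := uniqY _ (Upsilon_spec_conj hpsiU hpsiUi specY) N0.
  (* One truncation serves all uses: [N0] for the action, [n1] for uniqueness, 1 so that the
     constant term is present for cancellation. *)
  pose n := maxn (maxn N0 n1) 1; have gpY : graded (psiU \o Upsilon).
    by move=> mu; apply: psi_Uminus_wt.
  have le_N0 : (N0 <= n)%N by rewrite !leq_max leqnn.
  have le_n1 : (n1 <= n)%N by rewrite !leq_max leqnn orbT.
  rewrite !(actE n) // rho_psi psiK -rho_comp //.
  have TE : compl_sum (psiU \o Upsilon) n = psiU (S n) by rewrite /S !compl_sumE psi_sum.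
  (* Moving [psi] past the inner action turns [S n] into [psiU (S n)], so this product must act as
     the identity. *)
  suff /eqP : rho (S n * psiU (S n) - 1) = 0.
    by rewrite rhoB // rho1 subr_eq0 => /eqP->; rewrite id_lfunE.
  apply: (rho_compl_sum_cancel rho_mod gY Y0 (leq_maxr (maxn N0 n1) 1)).
  (* After multiplying by S on the right, S T S acts as the triple convolution because long words
     act by 0, and the convolution acts as S by uniqueness. *)
  rewrite mulrBl mul1r -TE.
  have /(fspan_lideal (N := N0)) := sum_conv3 n gY gpY gY.
  have /Jideal_lideal/(rho_lideal_eq0 rho_mod) := Hn1 n le_n1.
  rewrite rhoB // => /eqP; rewrite subr_eq0 => /eqP eq_rho.
  move=> /(_ (fun k => leq_trans le_N0))/(rho_lideal_eq0 rho_mod).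
  by rewrite !rhoB // eq_rho.
(* At level [N0] the intertwining congruence becomes an equality of operators on M. *)
- move=> u m; have [n1 Hn1] := intY u N0.
  have le1 := leq_maxl N0 n1; have le2 := leq_maxr N0 n1.
  rewrite !(actE _ _ le1) rho_psi -!rho_comp //.
  have /Jideal_lideal/(rho_lideal_eq0 rho_mod) := Hn1 _ le2.
  rewrite rhoB // => /eqP; rewrite subr_eq0 => /eqP eq_rho.
  by rewrite eq_rho.
Qed.
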